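(* There exists a function $f:\mathbb{R}\to\mathbb{R}$ which is $\mathcal{T}^+$-continuous (at every point of $\mathbb{R}$) but does not possess the Darboux property on any nondegenerate interval $I\subset\mathbb{R}$.
   Context: $\mathcal{L}$ is the family of Lebesgue measurable subsets of $\mathbb{R}$, $\lambda$ is Lebesgue measure. For $A\in\mathcal{L}$ and $x\in\mathbb{R}$ put $\bar D(A,x)=\limsup_{h\to0^+}\frac{\lambda(A\cap[x-h,x+h])}{2h}$, $\Phi^+(A)=\{x\in\mathbb{R}:\bar D(A,x)>0\}$, and $\mathcal{T}^+=\{A\in\mathcal{L}:A\subset\Phi^+(A)\}$. A function $f:\mathbb{R}\to\mathbb{R}$ is $\mathcal{T}^+$-continuous at $x_0$ if for every open set $U$ in the natural topology with $f(x_0)\in U$ there is $V\in\mathcal{T}^+$ with $x_0\in V$ and $f(V)\subset U$; it is $\mathcal{T}^+$-continuous if this holds at every $x_0\in\mathbb{R}$. A function has the Darboux property on an interval $I$ if it has the intermediate value property on $I$, i.e. the image of every subinterval of $I$ is connected. *)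

(* Defs.v *)
From HB Require Import structures.
From mathcomp Require Import all_boot all_order all_algebra.
From mathcomp Require Import all_classical all_reals all_analysis.

Set Implicit Arguments.
Unset Strict Implicit.
Unset Printing Implicit Defensive.

Import Order.TTheory GRing.Theory Num.Theory.
Import numFieldNormedType.Exports.

Local Open Scope classical_set_scope.
Local Open Scope ring_scope.

(* The Lebesgue sigma-algebra, not only the Borel one: the Caratheodory
   sets of Lebesgue outer measure are the domain of
   [completed_lebesgue_measure]; by [completed_caratheodory_measurable] they
   are exactly the unions of a Borel set and a Lebesgue-negligible set. *)
Definition lebesgue_measurable (R : realType) (A : set R) : Prop :=
  (@wlength R idfun)^*%mu.-cara.-measurable A.

Definition upper_density (R : realType) (A : set R) (x : R) : \bar R :=
  limf_esup
    (fun h : R =>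
       completed_lebesgue_measure (A `&` `[(x - h)%R, (x + h)%R]%classic)
         / (2 * h)%:E)%E
    0^'+.

Definition Phi_plus (R : realType) (A : set R) : set R :=
  [set x | (0 < upper_density A x)%E].

Definition T_plus (R : realType) : set (set R) :=
  [set A | lebesgue_measurable A /\ A `<=` Phi_plus A].

Definition T_plus_continuous_at (R : realType) (f : R -> R) (x0 : R) : Prop :=
  forall U : set R, open U -> U (f x0) ->
    exists V : set R, [/\ T_plus V, V x0 & f @` V `<=` U].

Definition T_plus_continuous (R : realType) (f : R -> R) : Prop :=
  forall x0 : R, T_plus_continuous_at f x0.

Definition nondegenerate_interval (R : realType) (I : set R) : Prop :=
  is_interval I /\ exists a b : R, [/\ I a, I b & a < b].

Definition darboux_on (R : realType) (I : set R) (f : R -> R) : Prop :=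
  forall J : set R, is_interval J -> J `<=` I -> connected (f @` J).

(* Main.v *)
Require Import Defs.
From mathcomp Require Import all_boot all_order all_algebra.
From mathcomp Require Import all_classical all_reals all_analysis.
From mathcomp Require Import lra.

(* The function is the indicator of a set [A] such that [A] and its complement
   are both dense and both in [T_plus]. Start from a Borel set [B] which, like
   its complement, has positive measure in every interval. The upper densities
   of [B] and of its complement at a point add up to at least 1, so one of them
   is positive; the points lying on a side of upper density 0 form a null set
   by the Lebesgue density theorem. Moving them to the other side yields [A]
   without changing any upper density. *)

Set Implicit Arguments.
Unset Strict Implicit.
Unset Printing Implicit Defensive.

Import Order.TTheory GRing.Theory Num.Theory.
Import numFieldNormedType.Exports.

Local Open Scope classical_set_scope.
Local Open Scope ring_scope.

(** * Upper density and null sets *)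

Section upper_density.
Context {R : realType}.
Local Open Scope ereal_scope.
Local Notation mu := (@completed_lebesgue_measure R).

(** [mu] unfolds to Lebesgue outer measure, so monotonicity and subadditivity apply to arbitrary
    sets. *)
Lemma le_completed_lebesgue (A B : set R) : A `<=` B -> mu A <= mu B.
Proof. exact: (le_outer_measure (@wlength R idfun)^*%mu). Qed.

Lemma completed_lebesgue_subnull (A B : set R) :
  A `<=` B -> mu B = 0 -> mu A = 0.
Proof.
move=> AB B0; apply/eqP; rewrite eq_le; apply/andP; split.
  by rewrite -B0; exact: le_completed_lebesgue.
exact: (outer_measure_ge0 (@wlength R idfun)^*%mu).
Qed.

Lemma completed_lebesgueU2 (A B : set R) : mu (A `|` B) <= mu A + mu B.
Proof. exact: (outer_measureU2 (@wlength R idfun)^*%mu). Qed.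

Lemma near_limf_esup_lt (f : R -> \bar R) (F : set_system R) (c : \bar R) :
  Filter F -> limf_esup f F < c -> \forall h \near F, f h < c.
Proof.
move=> FF /ereal_inf_lt[_ [V FV <-] supc].
apply: filterS FV => h Vh; apply: le_lt_trans supc.
by apply: ereal_sup_ubound; exists h.
Qed.

(** The bound [h] comes from the ratio threshold 1/2: two sets that each fill less than half of a
    window of length [2 * h] cannot cover it. *)
Lemma near_upper_density0 (A : set R) (x : R) : ~ 0 < upper_density A x ->
  \forall h \near 0^'+, mu (A `&` `[(x - h)%R, (x + h)%R]) < h%:E.
Proof.
move=> /negP; rewrite -leNgt => D0.
have /near_limf_esup_lt Dlt : upper_density A x < (2^-1)%:E.
  by apply: le_lt_trans D0 _; rewrite lte_fin.
apply: filterS2 Dlt (nbhs_right_gt 0) => h + h0.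
have h2 : (0 < 2 * h)%R by rewrite mulr_gt0.
by rewrite inver gt_eqF// lte_pdivrMr// -EFinM mulrA mulVf// mul1r.
Qed.

Lemma le_limf_esup (f g : R -> \bar R) (F : set_system R) :
  Filter F -> (\forall h \near F, f h <= g h) ->
  limf_esup f F <= limf_esup g F.
Proof.
move=> FF fg; apply: le_ereal_inf_tmp => _ [V FV <-].
apply: (@le_trans _ _ (ereal_sup (f @` (V `&` [set h | f h <= g h])))).
  apply: ereal_inf_lbound; exists (V `&` [set h | f h <= g h]) => //.
  exact: filterI.
apply: ge_ereal_sup => _ [h [Vh fgh] <-]; apply: le_trans fgh _.
by apply: ereal_sup_ubound; exists h.
Qed.

(** [A] is covered by [B] and a null set, so the ratios compare at every [h > 0]. *)
Lemma le_upper_density (A B : set R) (x : R) :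
  mu (A `\` B) = 0 -> upper_density A x <= upper_density B x.
Proof.
move=> AB0; apply: le_limf_esup.
apply: filterS (nbhs_right_gt 0) => h h0.
rewrite /= lee_wpmul2r//.
  by rewrite inve_ge0 lee_fin mulr_ge0// ltW.
rewrite -[leRHS]adde0 -AB0; apply: le_trans (completed_lebesgueU2 _ _).
apply: le_completed_lebesgue => y [Ay xhy].
by have [By|nBy] := pselect (B y); [left|right].
Qed.

Lemma upper_density_setC (A : set R) (x : R) :
  0 < upper_density A x \/ 0 < upper_density (~` A) x.
Proof.
apply: contrapT => /not_orP[/near_upper_density0 nA /near_upper_density0 nC].
near (0 : R)^'+ => h.
have h0 : (0 < h)%R by near: h; exact: nbhs_right_gt.
have hA : mu (A `&` `[(x - h)%R, (x + h)%R]) < h%:E by near: h.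
have hC : mu (~` A `&` `[(x - h)%R, (x + h)%R]) < h%:E by near: h.
have : (h + h)%:E <= mu (A `&` `[(x - h)%R, (x + h)%R]) +
    mu (~` A `&` `[(x - h)%R, (x + h)%R]).
  apply: le_trans (completed_lebesgueU2 _ _).
  rewrite -setIUl setUCr setTI.
  have -> : mu `[(x - h)%R, (x + h)%R] = lebesgue_measure `[(x - h)%R, (x + h)%R] by [].
  rewrite lebesgue_measure_itv/= lte_fin ifT; last lra.
  rewrite -EFinB lee_fin; lra.
by rewrite leNgt EFinD lteD.
Unshelve. all: by end_near. Qed.

(** At a point of [B] outside [Phi_plus B] the ratios stay below 1/2 near 0, whereas the density
    theorem gives them the limit 1 at almost every point of [B]. *)
Lemma upper_density_gt0_ae (B : set R) : measurable B ->
  (@lebesgue_measure R).-negligible (B `\` Phi_plus B).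
Proof.
move=> mB; apply: negligibleS (lebesgue_density mB) => x [Bx nDx] /= dx.
apply: nDx; rewrite /Phi_plus/=; apply: contrapT => /near_upper_density0 D0.
have : (1%:E <= (2^-1)%:E :> \bar R); last by rewrite lee_fin; lra.
move: dx; rewrite indicE mem_set// => dx.
apply: (cvge_le _ dx).
apply: filterS2 D0 (nbhs_right_gt 0) => h Dh h0.
have h2 : (0 < h *+ 2)%R by rewrite mulrn_wgt0.
rewrite (lebesgue_measure_ball _ (ltW h0)) inver gt_eqF// lee_pdivrMr//.
rewrite -EFinM -(mulr_natl h 2) mulKf//.
apply: le_trans (ltW Dh); apply: le_completed_lebesgue => y [By].
rewrite /ball/= ltr_distlC => /andP[xhy yxh]; split=> //.
by rewrite /= in_itv/= !ltW.
Qed.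

(** Completeness: [N] lies in a Borel null set, and subsets of such a set are Caratheodory
    measurable. *)
Lemma negligible_completed_lebesgue (N : set R) :
  (@lebesgue_measure R).-negligible N -> mu N = 0 /\ lebesgue_measurable N.
Proof.
move=> [M [mM M0 NM]].
have muN : mu N = 0 by exact: completed_lebesgue_subnull NM M0.
split=> //; apply: negligible_sub_caratheodory.
by exists M; split => //; exact: sub_caratheodory.
Qed.

(** The two null differences are recorded because they let [A] and its complement inherit from [B]
    that they meet every interval. *)
Lemma T_plus_modification (B : set R) : measurable B ->
  exists A : set R, [/\ T_plus A, T_plus (~` A),
    mu (B `\` A) = 0 & mu (~` B `\` ~` A) = 0].
Proof.
move=> mB.
pose P := B `\` Phi_plus B; pose Q := ~` B `\` Phi_plus (~` B).
have [P0 mP] := negligible_completed_lebesgue (upper_density_gt0_ae mB).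
have [Q0 mQ] := negligible_completed_lebesgue
  (upper_density_gt0_ae (measurableC mB)).
pose A := (B `\` P) `|` Q.
have BA : mu (B `\` A) = 0.
  apply: completed_lebesgue_subnull P0 => x [Bx nAx]; apply: contrapT => nPx.
  by apply: nAx; left.
have BCAC : mu (~` B `\` ~` A) = 0.
  by apply: completed_lebesgue_subnull Q0 => x [nBx /contrapT[[]|]].
have mA : lebesgue_measurable A.
  apply: caratheodory_measurable_setU; last exact: mQ.
  apply: caratheodory_measurable_setD; last exact: mP.
  exact: sub_caratheodory.
exists A; split=> //; split.
- exact: mA.
(* It suffices that [B] has positive upper density at [x]. Off [P] this is the definition of [P]; on
   [Q] the complement of [B] has upper density 0, so [B] does not. *)
- move=> x Ax; apply: lt_le_trans (le_upper_density x BA).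
  case: Ax => [[Bx nPx]|[nBx nQx]]; first by apply: contrapT => nDx; exact: nPx.
  by case: (upper_density_setC B x).
- exact: caratheodory_measurable_setC.
- move=> x nAx; apply: lt_le_trans (le_upper_density x BCAC).
  have [Bx|nBx] := pselect (B x).
    have [DB|//] := upper_density_setC B x.
    by exfalso; apply: nAx; left; split => // -[].
  by apply: contrapT => nDx; apply: nAx; right.
Qed.

End upper_density.

(** * A Borel set splitting every interval into two parts of positive measure *)

Section interval_bisecting_set.
Context {R : realType}.
Local Notation mu := (@lebesgue_measure R).

(* Every rational is the center of [G n] for infinitely many [n] of either
   parity of [logn 3 n]. The radii decay so fast that [G n] is not covered by the
   later balls; the remainders [F n] are disjoint and are distributed between
   [B] and its complement according to that parity. *)
Let center (n : nat) : R := ratr (odflt 0 (unpickle (logn 2 n))).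
Let G (n : nat) : set R := ball (center n) (4 ^- n).
Let tail (n : nat) : set R := \bigcup_k G (n.+1 + k).
Let F (n : nat) : set R := G n `\` tail n.

Let mG n : measurable (G n). Proof. exact: measurable_realfun.measurable_ball. Qed.
Let mtail n : measurable (tail n).
Proof. exact: bigcupT_measurable. Qed.
Let mF n : measurable (F n).
Proof. exact: measurableD. Qed.

Let r_gt0 n : 0 < 4 ^- n :> R. Proof. by rewrite invr_gt0 exprn_gt0. Qed.

Let muG n : mu (G n) = (4 ^- n *+ 2)%:E.
Proof. by rewrite lebesgue_measure_ball// ltW. Qed.

(** The [k]-th later ball has measure at most [4 ^- n / 2 ^ k.+1], and these bounds sum to [4 ^- n],
    half the measure of [G n]. *)
Let mu_tail n : (mu (tail n) <= (4 ^- n)%:E)%E.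
Proof.
apply: le_trans (epsilon_trick0 xpredT (ltW (r_gt0 n))).
have le_series : (mu (tail n) <= \sum_(0 <= k <oo) mu (G (n.+1 + k)))%E.
  apply: measure_sigma_subadditive => //; [move=> k; exact: mG|exact: mtail].
apply: le_trans le_series _; apply: lee_nneseries => k // _.
rewrite muG lee_fin addSn exprS exprD natrX exprS !invfM.
have -> : 4^-1 * (4 ^- n * 4 ^- k) *+ 2 = (4 ^- n * 2^-1) * 4 ^- k :> R by lra.
rewrite mulrA ler_pM2l ?mulr_gt0//.
by rewrite lef_pV2 ?posrE ?exprn_gt0// lerXn2r ?nnegrE// ler_nat.
Qed.

Let mu_F n : (0 < mu (F n))%E.
Proof.
rewrite lt0e measure_ge0 andbT; apply/eqP => F0.
have : (mu (G n) <= mu (F n) + mu (tail n))%E.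
  apply: le_trans (measureU2 mu (mF n) (mtail n)).
  apply: le_measure; rewrite ?inE; [exact: mG| |].
    by apply: measurableU; [exact: mF|exact: mtail].
  by move=> x Gx; have [Tx|nTx] := pselect (tail n x); [right|left].
rewrite F0 add0e leNgt => /negP; apply; apply: le_lt_trans (mu_tail n) _.
by rewrite muG lte_fin mulr2n ltrDl.
Qed.

Let F_disjoint m n x : (m < n)%N -> F m x -> ~ G n x.
Proof.
move=> mn [_ nTx] Gnx; apply: nTx; exists (n - m.+1)%N => //.
by rewrite subnKC.
Qed.

Let exists_G (a b : R) (p : bool) : a < b ->
  exists2 n, odd (logn 3 n) = p & G n `<=` `]a, b[.
Proof.
move=> /rat_in_itvoo[q]; rewrite in_itv/= => /andP[aq qb].
pose e := Num.min (ratr q - a) (b - ratr q).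
have e0 : 0 < e by rewrite lt_min !subr_gt0 aq.
pose m := Num.bound e^-1.
(* The exponent of 2 encodes the center [q]. The exponent of 3 has parity [p] and is at least [m],
   so that [e^-1 < m <= n <= 4 ^ n]. *)
pose n := (2 ^ pickle q * 3 ^ (m.*2 + p))%N.
have n2 : logn 2 n = pickle q.
  by rewrite lognM ?expn_gt0// !lognX !logn_prime// muln0 muln1 addn0.
have n3 : logn 3 n = (m.*2 + p)%N.
  by rewrite lognM ?expn_gt0// !lognX !logn_prime// muln0 muln1.
have mn : (m <= n)%N.
  apply: (@leq_trans (3 ^ (m.*2 + p))); last by rewrite leq_pmull ?expn_gt0.
  apply: leq_trans (ltnW (ltn_expl _ _)) => //.
  by rewrite -addnn -addnA leq_addr.
exists n; first by rewrite n3 oddD odd_double oddb.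
have rn : 4 ^- n < e.
  rewrite -[ltRHS]invrK ltf_pV2 ?posrE ?invr_gt0 ?exprn_gt0//.
  apply: lt_le_trans (archi_boundP _) _; first by rewrite invr_ge0 ltW.
  rewrite -natrX ler_nat (leq_trans mn)// ltnW// ltn_expl//.
rewrite /G /center n2 pickleK => x; rewrite /ball/= ltr_distlC => /andP[].
by move: rn; rewrite lt_min in_itv/= => /andP[]; lra.
Qed.

Lemma interval_bisecting_set : exists2 B : set R, measurable B &
  forall a b : R, a < b ->
    (0 < mu (B `&` `]a, b[) /\ 0 < mu (~` B `&` `]a, b[))%E.
Proof.
pose B := \bigcup_(n in [set n | odd (logn 3 n)]) F n.
have mB : measurable B by exact: bigcup_measurable.
exists B => // a b ab.
have FB p n : odd (logn 3 n) = p -> F n `<=` (if p then B else ~` B).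
  case: p => np x Fx; first by exists n.
  move=> [m pm Fmx]; have := ltngtP m n.
  case=> [mn|nm|mn].
  - exact: (F_disjoint mn Fmx Fx.1).
  - exact: (F_disjoint nm Fx Fmx.1).
  - by move: pm; rewrite /= mn np.
have pos p : (0 < mu ((if p then B else ~` B) `&` `]a, b[))%E.
  have [n np Gab] := exists_G p ab.
  apply: lt_le_trans (mu_F n) _; apply: le_measure; rewrite ?inE; first exact: mF.
    apply: measurableI; last exact: measurable_itv.
    by case: p {np} => //; exact: measurableC.
  move=> x Fx; split; [exact: FB np _ Fx|exact/Gab/Fx.1].
by split; [exact: (pos true)|exact: (pos false)].
Qed.

End interval_bisecting_set.

Theorem theorem15 (R : realType) :
  exists f : R -> R,
    T_plus_continuous f /\
    forall I : set R, nondegenerate_interval I -> ~ darboux_on I f.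
Proof.
have [B mB Bab] := @interval_bisecting_set R.
have [A [TA TnA BA BCAC]] := T_plus_modification mB.
exists (\1_A); split.
  (* The indicator is constant on [A] and on its complement; whichever contains [x] serves for every
     [U]. *)
  move=> x U _; rewrite indicE; have [xA|xA] := boolP (x \in A) => Ux.
    exists A; split => //; first exact/set_mem.
    by move=> _ [y Ay <-]; rewrite indicE mem_set.
  exists (~` A); split => //; first by move=> /mem_set; exact/negP.
  by move=> _ [y Ay <-]; rewrite indicE memNset.
move=> I [itvI [a [b [Ia Ib ab]]]] /(_ I itvI (@subset_refl _ I)).
have abI : `]a, b[ `<=` I.
  move=> x /=; rewrite in_itv => /andP[ax xb].
  by apply: itvI Ia Ib _ _; rewrite !ltW.
(* If [D] missed [I], then [C] inside []a, b[] would be contained in the null set [C] minus [D]. *)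
have meets (C D : set R) : (0 < lebesgue_measure (C `&` `]a, b[))%E ->
    completed_lebesgue_measure (C `\` D) = 0%E -> exists2 x, D x & I x.
  move=> C0 CD0; apply: contrapT => DI; move: C0; apply/negP; rewrite -leNgt.
  rewrite -CD0; apply: le_completed_lebesgue => x [Cx xab]; split => // Dx.
  by apply: DI; exists x => //; exact: abI.
have [C0 nC0] := Bab a b ab.
have [x Ax Ix] := meets _ _ C0 BA; have [y nAy Iy] := meets _ _ nC0 BCAC.
(* A connected image containing 0 and 1 would contain 1/2, which is not a value of an indicator. *)
move=> /connected_intervalP/(_ 0 1).
have f0 : (\1_A @` I) (0 : R) by exists y => //; rewrite indicE memNset.
have f1 : (\1_A @` I) (1 : R) by exists x => //; rewrite indicE mem_set.
move=> /(_ f0 f1 (2^-1)); case.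
  by rewrite invr_ge0 ler0n/= invf_le1// ler1n.
move=> z _; rewrite indicE; case: (z \in A) => /=; lra.
Qed.
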